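(* Let $E$ be a complex normed space, and take $n\in\mathbb N$. Then $$\varphi_n^{\max}(E)=\sup\Big\{\sum_{j=1}^n\|\lambda_j\| : \mu_{1,n}(\lambda_1,\dots,\lambda_n)\le1\Big\}=\sup\Big\{\sum_{j=1}^n\|\lambda_j\| : \Big\|\sum_{j=1}^n\zeta_j\lambda_j\Big\|\le1\ (\zeta_1,\dots,\zeta_n\in\mathbb T)\Big\},$$ where the suprema are taken over $\lambda_1,\dots,\lambda_n\in E'$, and so $$\varphi_n^{\max}(E)=\pi_1^{(n)}(E')\ge n/c_n(E').$$
   Context: $\mathbb T=\{\zeta\in\mathbb C:|\zeta|=1\}$. A multi-norm based on a complex normed space $(E,\|\cdot\|)$ is a sequence $(\|\cdot\|_k:k\in\mathbb N)$, with $\|\cdot\|_k$ a norm on $E^k$ and $\|x\|_1=\|x\|$, such that for each $k\ge2$: (A1) $\|(x_{\sigma(1)},\dots,x_{\sigma(k)})\|_k=\|(x_1,\dots,x_k)\|_k$ for each permutation $\sigma$ of $\{1,\dots,k\}$; (A2) $\|(\alpha_1x_1,\dots,\alpha_kx_k)\|_k\le(\max_i|\alpha_i|)\|(x_1,\dots,x_k)\|_k$ for $\alpha_i\in\mathbb C$; (A3) $\|(x_1,\dots,x_{k-1},0)\|_k=\|(x_1,\dots,x_{k-1})\|_{k-1}$; (A4) $\|(x_1,\dots,x_{k-2},x_{k-1},x_{k-1})\|_k=\|(x_1,\dots,x_{k-1})\|_{k-1}$, for all $x_i\in E$. The maximum multi-norm $(\|\cdot\|_n^{\max})$ based on $E$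 is the pointwise supremum of all multi-norms based on $E$ (it is itself a multi-norm), and $\varphi_n^{\max}(E)=\sup\{\|(x_1,\dots,x_n)\|_n^{\max}:x_i\in E,\ \|x_i\|\le1\}$. For a normed space $F$ and $x_1,\dots,x_n\in F$: $\mu_{1,n}(x_1,\dots,x_n)=\sup\{\sum_{j=1}^n|\langle x_j,\lambda\rangle|:\lambda\in F',\|\lambda\|\le1\}$; $\pi_1^{(n)}(F)=\sup\{\sum_{j=1}^n\|x_j\| : x_1,\dots,x_n\in F,\ \mu_{1,n}(x_1,\dots,x_n)\le1\}$; $c_n(F)=\inf\{\sup\{\|\zeta_1x_1+\cdots+\zeta_nx_n\|:\zeta_1,\dots,\zeta_n\in\mathbb T\}:x_1,\dots,x_n\in F,\ \|x_1\|=\cdots=\|x_n\|=1\}$. *)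

(* Defs.v *)
From HB Require Import structures.
From mathcomp Require Import all_boot all_order all_algebra all_fingroup.
From mathcomp Require Import all_classical all_reals all_analysis.
From mathcomp Require Export complex.

Set Implicit Arguments.
Unset Strict Implicit.
Unset Printing Implicit Defensive.

Import Order.TTheory GRing.Theory Num.Theory.
Import numFieldNormedType.Exports.
Local Open Scope classical_set_scope.
Local Open Scope ring_scope.
Local Open Scope complex_scope.

(* The library norm on a [normedModType R[i]] takes its values in [R[i]]
   (they are real and nonnegative); [rnorm] is the same norm read in [R]. *)
Definition rnorm (R : realType) (F : normedModType R[i]) (x : F) : R :=
  complex.Re `|x|.

Section RealNorm.
Variables (R : realType) (F : normedModType R[i]).
Implicit Types x y : F.

Lemma rnormE x : (rnorm x)%:C = `|x|.
Proof.
by have := normr_ge0 x; rewrite /rnorm; case: `|x| => a b; rewrite lecE/= =>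
  /andP[/eqP -> _].
Qed.

Lemma rnorm_ge0 x : 0 <= rnorm x.
Proof. by rewrite -lecR rnormE normr_ge0. Qed.

Lemma rnormD x y : rnorm (x + y) <= rnorm x + rnorm y.
Proof. by rewrite -lecR rmorphD/= !rnormE ler_normD. Qed.

Lemma rnormZ (a : R[i]) x : rnorm (a *: x) = rnorm (a : R[i]^o) * rnorm x.
Proof.
have : (rnorm (a *: x))%:C = (rnorm (a : R[i]^o) * rnorm x)%:C.
  by rewrite rmorphM/= !rnormE normrZ.
by case.
Qed.

Lemma rnorm0 : rnorm (0 : F) = 0.
Proof. by rewrite /rnorm normr0. Qed.

Lemma rnorm0_eq0 x : rnorm x = 0 -> x = 0.
Proof. by move=> x0; apply/eqP; rewrite -normr_eq0 -rnormE x0. Qed.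

End RealNorm.

Section TopologicalDual.
Variables (R : realType) (E : normedModType R[i]).

Definition is_functional : {pred E -> R[i]^o} :=
  fun f => `[< linear f /\ continuous f >].

Record topdual := Topdual {
  dual_fun :> E -> R[i]^o ;
  _ : dual_fun \in is_functional }.

HB.instance Definition _ := [isSub for dual_fun].
HB.instance Definition _ := [Choice of topdual by <:].

Lemma is_functionalP (f : E -> R[i]^o) :
  reflect (linear f /\ continuous f) (f \in is_functional).
Proof. exact: asboolP. Qed.

Lemma is_functional_submod : submod_closed is_functional.
Proof.
split.
  apply/is_functionalP; split => [a x y /=|]; last exact: cst_continuous.
  by rewrite /GRing.zero/= scaler0 addr0.
move=> a f g /is_functionalP[lf cf] /is_functionalP[lg cg].
apply/is_functionalP; split => [b x y|x].
  rewrite !fctE lf lg !scalerDr !scalerA.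
  by rewrite addrACA (mulrC a b).
by apply: cvgD; [apply: cvgZl_tmp; exact: cf|exact: cg].
Qed.

HB.instance Definition _ :=
  GRing.isSubmodClosed.Build R[i] (E -> R[i]^o) is_functional
    is_functional_submod.
HB.instance Definition _ := [SubChoice_isSubLmodule of topdual by <:].

Lemma topdual_linear (f : topdual) : linear f.
Proof. by have /is_functionalP[] := valP f. Qed.

HB.instance Definition _ (f : topdual) :=
  GRing.isLinear.Build R[i] E R[i]^o *:%R (f : E -> R[i]^o) (topdual_linear f).

Lemma topdual_continuous (f : topdual) : continuous f.
Proof. by have /is_functionalP[] := valP f. Qed.

Let ball_values (f : topdual) : set R :=
  [set rnorm (f x) | x in [set x | rnorm x <= 1]].

Definition opnorm (f : topdual) : R := sup (ball_values f).

Let ball_values0 f : ball_values f !=set0.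
Proof.
by exists (rnorm (f 0)), 0 => //; rewrite /= rnorm0 ler01.
Qed.

Let ball_values_ub f : has_ubound (ball_values f).
Proof.
have /continuous_linear_bounded/linear_boundedP/pinfty_ex_gt0[M M0 fM] :
  {for 0, continuous f} by exact: topdual_continuous.
exists (complex.Re M) => _ [x /= x1 <-].
have := fM x; rewrite -!rnormE.
have {fM M0}[m m0 ->] : exists2 m : R, 0 <= m & M = m%:C.
  case: M M0 {fM} => a b; rewrite ltcE/= => /andP[/eqP-> /ltW a0].
  by exists a.
by rewrite -rmorphM/= lecR => /le_trans; apply; rewrite ler_piMr.
Qed.

Let ball_values_sup f : has_sup (ball_values f).
Proof. by split. Qed.

Lemma opnorm_ge (f : topdual) x : rnorm x <= 1 -> rnorm (f x) <= opnorm f.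
Proof. by move=> x1; apply: sup_upper_bound => //; exists x. Qed.

Lemma opnorm_le (f : topdual) M :
  (forall x, rnorm x <= 1 -> rnorm (f x) <= M) -> opnorm f <= M.
Proof. by move=> fM; apply: ge_sup => // _ [x /= x1 <-]; exact: fM. Qed.

Lemma topdualDE (f g : topdual) x : (f + g) x = f x + g x. Proof. by []. Qed.
Lemma topdualZE (a : R[i]) (f : topdual) x : (a *: f) x = a *: f x.
Proof. by []. Qed.

Lemma opnormD (f g : topdual) :
  (opnorm (f + g))%:C <= (opnorm f)%:C + (opnorm g)%:C.
Proof.
rewrite -rmorphD/= lecR; apply: opnorm_le => x x1.
by rewrite topdualDE (le_trans (rnormD _ _))// lerD// opnorm_ge.
Qed.

Lemma opnorm_ge0 f : 0 <= opnorm f.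
Proof. by rewrite (le_trans (rnorm_ge0 (f 0)))// opnorm_ge// rnorm0. Qed.

Let opnormZ_le (a : R[i]) (f : topdual) :
  opnorm (a *: f) <= rnorm (a : R[i]^o) * opnorm f.
Proof.
apply: opnorm_le => x x1.
by rewrite topdualZE rnormZ ler_wpM2l ?rnorm_ge0 ?opnorm_ge.
Qed.

Lemma opnormZ (a : R[i]) (f : topdual) :
  (opnorm (a *: f))%:C = `|a| * (opnorm f)%:C.
Proof.
rewrite -[`|a|](rnormE (a : R[i]^o)) -rmorphM/=; congr _%:C.
apply/eqP; rewrite eq_le opnormZ_le/=.
have [->|a0] := eqVneq a 0; first by rewrite rnorm0 mul0r opnorm_ge0.
have na0 : 0 < rnorm (a : R[i]^o) by rewrite -ltcR rnormE normr_gt0.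
rewrite -ler_pdivlMl// -[X in opnorm X <= _](scalerK a0).
rewrite (le_trans (opnormZ_le _ _))// ler_wpM2r ?opnorm_ge0//.
by rewrite -lecR rnormE normfV fmorphV/= rnormE.
Qed.

Lemma opnorm_eq0 (f : topdual) : (opnorm f)%:C = 0 -> f = 0.
Proof.
case=> f0; apply/val_inj/funext => x /=.
have [->|x0] := eqVneq x 0; first by rewrite linear0.
have nx0 : `|x| != 0 by rewrite normr_eq0.
have : rnorm (f (`|x|^-1 *: x)) <= 0.
  rewrite -f0 opnorm_ge// -lecR rnormE normrZ normfV normr_id mulVf//.
rewrite linearZ/= => fx0.
have /rnorm0_eq0/eqP : rnorm (`|x|^-1 *: f x) = 0.
  by apply/eqP; rewrite eq_le fx0 rnorm_ge0.
by rewrite scaler_eq0 invr_eq0 (negPf nx0) => /eqP.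
Qed.

HB.instance Definition _ :=
  Lmodule_isNormed.Build R[i] topdual opnormD opnormZ opnorm_eq0.

Lemma rnorm_topdual (f : topdual) : rnorm f = opnorm f.
Proof. by []. Qed.

End TopologicalDual.

Section Constants.
Variables (R : realType) (F : normedModType R[i]) (n : nat).
Local Open Scope ereal_scope.

Definition mu1 (x : 'I_n -> F) : \bar R :=
  ereal_sup [set (\sum_(j < n) rnorm (lambda (x j)))%:E
            | lambda in [set lambda : topdual F | (rnorm lambda <= 1)%R]].

Definition pi1 : \bar R :=
  ereal_sup [set (\sum_(j < n) rnorm (x j))%:E
            | x in [set x : 'I_n -> F | mu1 x <= 1]].

Definition torus : set ('I_n -> R[i]) :=
  [set zeta | forall j, `|zeta j|%R = 1%R].

(* The infimum of the empty set is [+oo], and [r%:E / +oo = 0]. *)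
Definition cconst : \bar R :=
  ereal_inf [set ereal_sup [set (rnorm (\sum_(j < n) zeta j *: x j))%:E
                           | zeta in torus]
            | x in [set x : 'I_n -> F | forall j, rnorm (x j) = 1%R]].

End Constants.
Arguments pi1 {R} F n.
Arguments torus R n : clear implicits.
Arguments cconst {R} F n.

Section MultiNorm.
Variables (R : realType) (E : normedModType R[i]).

Record is_norm (V : lmodType R[i]) (p : V -> R) : Prop := IsNorm {
  is_normD : forall x y, p (x + y) <= p x + p y ;
  is_normZ : forall (a : R[i]) x, p (a *: x) = complex.Re `|a| * p x ;
  is_norm_eq0 : forall x, p x = 0 -> x = 0 }.

Definition append k (x : 'I_k -> E) (y : E) : 'I_k.+1 -> E :=
  fun i => oapp x y (unlift ord_max i).

(* [N k] is the norm on E^k for k >= 1; [N 0] is irrelevant. In the axioms,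
   the index k >= 2 is written [k.+2]. *)
Record multinorm (N : forall k, ('I_k -> E) -> R) : Prop := Multinorm {
  multinorm_norm : forall k, is_norm (N k.+1) ;
  multinorm1 : forall x : E, N 1%N (fun=> x) = rnorm x ;
  multinormA1 : forall k (s : 'S_k.+2) (x : 'I_k.+2 -> E),
    N k.+2 (x \o s) = N k.+2 x ;
  multinormA2 : forall k (a : 'I_k.+2 -> R[i]) (x : 'I_k.+2 -> E),
    N k.+2 (fun i => a i *: x i) <=
      (\big[Order.max/0]_(i < k.+2) complex.Re `|a i|) * N k.+2 x ;
  multinormA3 : forall k (x : 'I_k.+1 -> E), N k.+2 (append x 0) = N k.+1 x ;
  multinormA4 : forall k (x : 'I_k.+1 -> E),
    N k.+2 (append x (x ord_max)) = N k.+1 x }.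

Definition max_multinorm n (x : 'I_n -> E) : \bar R :=
  ereal_sup [set (N n x)%:E | N in multinorm].

Definition phi_max n : \bar R :=
  ereal_sup [set max_multinorm x
            | x in [set x : 'I_n -> E | forall i, rnorm (x i) <= 1]].

End MultiNorm.
Arguments phi_max {R} E n.

(* Main.v *)
From HB Require Import structures.
Require Import Defs.
From mathcomp Require Import all_boot all_order all_algebra all_fingroup.
From mathcomp Require Import all_classical all_reals all_analysis.
Import Order.TTheory GRing.Theory Num.Theory.
Import numFieldNormedType.Exports.
Set Implicit Arguments.
Unset Strict Implicit.
Unset Printing Implicit Defensive.
Local Open Scope classical_set_scope.
Local Open Scope ring_scope.
Local Open Scope complex_scope.

(* By duality, the maximum multi-norm of [x] is
   [sup |\sum_j l j (x j)|] over the families [l] with [mu1 l <= 1]. This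
   supremum is a multi-norm since both [mu1] and the pairing behave well under
   [x |-> (a i *: x (s i))_i], an operation of which (A1)-(A4) are special
   cases. It dominates any other multi-norm [N]: a Hahn-Banach functional for
   [N n] at [x] has coordinates [l j] in [E'] with [mu1 l <= 1], because
   [N n (zeta 0 *: y, ...) <= |y|] by (A2) and (A4). Taking the supremum over
   the unit ball coordinatewise turns the pairing into [\sum_j |l j|].
   For the last inequality, a family of unit vectors is divided by the
   supremum of the norms of its unimodular combinations. *)

(** * The Hahn-Banach theorem *)

Section HahnBanach.
Variables (R : realType) (V : lmodType R[i]).
Implicit Types (p q : V -> R) (x y : V) (s t : R).

(** [V] is treated as a real space here, so scalars are real and nonnegative. Applying the
    inequality to [t] and to its inverse gives equality for [t > 0]. *)
Record sublinear p : Prop := Sublinear {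
  sublinearD : forall x y, p (x + y) <= p x + p y ;
  sublinearZ_le : forall t x, 0 <= t -> p (t%:C *: x) <= t * p x }.

Lemma sublinear0 p : sublinear p -> p 0 = 0.
Proof.
move=> hp; apply/eqP; rewrite eq_le; apply/andP; split.
  by have := sublinearZ_le hp 0 (lexx 0); rewrite scaler0 mul0r.
by have := sublinearD hp 0 0; rewrite addr0 -subr_ge0 addrK.
Qed.

Lemma sublinearN_ge p x : sublinear p -> - p (- x) <= p x.
Proof.
move=> hp; rewrite -subr_ge0 opprK -(sublinear0 hp).
by rewrite -(subrr x) (sublinearD hp).
Qed.

Lemma sublinearZ p t x : sublinear p -> 0 <= t -> p (t%:C *: x) = t * p x.
Proof.
move=> hp t0; apply/eqP; rewrite eq_le (sublinearZ_le hp)//=.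
have [->|tn0] := eqVneq t 0; first by rewrite scale0r sublinear0 ?mul0r.
have tC0 : t%:C != 0 by rewrite fmorph_eq0.
have tp : 0 < t by rewrite lt_def tn0.
rewrite -ler_pdivlMl// -{1}[x](scalerK tC0) -fmorphV.
by rewrite (sublinearZ_le hp)// invr_ge0.
Qed.

(* The reason why a minimal sublinear functional is additive: minimality forces
   [contract p y = p] for all [y]. *)
Section ContractSublinear.
Variables (p : V -> R) (hp : sublinear p) (y : V).

Definition contract x : R :=
  inf [set p (x + t%:C *: y) - t * p y | t in [set t | 0 <= t]].

Let contract_lb x :
  has_lbound [set p (x + t%:C *: y) - t * p y | t in [set t | 0 <= t]].
Proof.
(* Subadditivity for [t y = (x + t y) + (- x)]. *)
exists (- p (- x)) => _ [t /= t0 <-].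
rewrite lerBrDr -(sublinearZ _ hp t0) addrC lerBlDr.
by rewrite (le_trans _ (sublinearD hp _ _))// addrAC subrr add0r.
Qed.

Lemma contract_le_shift x t : 0 <= t ->
  contract x <= p (x + t%:C *: y) - t * p y.
Proof. by move=> t0; apply: ge_inf => //; exists t. Qed.

Lemma contract_ge x c :
  (forall t, 0 <= t -> c <= p (x + t%:C *: y) - t * p y) -> c <= contract x.
Proof.
move=> h; apply: lb_le_inf; last by move=> _ [t t0 <-]; exact: h.
by exists (p (x + 0%:C *: y) - 0 * p y), 0 => /=.
Qed.

Lemma contract_le x : contract x <= p x.
Proof.
have := contract_le_shift x (lexx 0).
by rewrite scale0r addr0 mul0r subr0.
Qed.

Lemma contractN : contract (- y) <= - p y.
Proof.
have := contract_le_shift (- y) ler01.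
by rewrite scale1r addNr mul1r sublinear0 ?sub0r.
Qed.

Lemma contract_sublinear : sublinear contract.
Proof.
split=> [x x'|s x s0].
  rewrite -lerBlDr; apply: contract_ge => t t0.
  rewrite lerBlDr -lerBlDl; apply: contract_ge => t' t'0.
  (* The parameters [t] for [x] and [t'] for [x'], in whichever order, add up to an admissible
     parameter for [x + x']. *)
  rewrite lerBlDl (le_trans (contract_le_shift _ (addr_ge0 t0 t'0)))//.
  rewrite mulrDl opprD addrACA lerD2r rmorphD/= scalerDl addrACA.
  exact: sublinearD.
have [->|sn0] := eqVneq s 0.
  by rewrite scale0r mul0r (le_trans (contract_le _))// sublinear0.
have sp : 0 < s by rewrite lt_def sn0.
rewrite -ler_pdivrMl//; apply: contract_ge => t t0; rewrite ler_pdivrMl//.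
rewrite (le_trans (contract_le_shift _ (mulr_ge0 s0 t0)))//.
by rewrite mulrBr mulrA lerD2r -(sublinearZ _ hp s0) scalerDr scalerA rmorphM.
Qed.

End ContractSublinear.

(* Zorn's lemma: a chain of sublinear functionals below [p] is bounded below
   by its pointwise infimum, which is finite since [q x >= - p (- x)]. *)
Lemma minimal_sublinear p : sublinear p ->
  exists q, [/\ sublinear q, forall x, q x <= p x &
    forall r, sublinear r -> (forall x, r x <= q x) -> r = q].
Proof.
move=> hp.
pose T := {q : V -> R | sublinear q /\ forall x, q x <= p x}.
(* The pointwise order is reversed: a maximal element for [le] is a minimal functional. *)
pose le (q r : T) : bool := `[< forall x, sval r x <= sval q x >].
have [| | | |[q [hq qp]] qmin] := @Zorn T le.
- by move=> q; apply/asboolP.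
- move=> q r s /asboolP qr /asboolP rs; apply/asboolP => x.
  exact: le_trans (rs x) (qr x).
- move=> [q hq] [r hr] /asboolP/= qr /asboolP/= rq; apply/eq_exist/funext => x.
  by apply/eqP; rewrite eq_le qr rq.
- move=> A chainA.
  (* Adjoining [p] keeps the infimum over a nonempty set even for the empty chain. *)
  pose B := [set q | q = p \/ exists2 r, A r & sval r = q].
  have Bp : B p by left.
  have Bsub q : B q -> sublinear q by case=> [->//|[[r [hr rp]] Ar <-]].
  have Ble q x : B q -> q x <= p x.
    by case=> [->//|[[r [hr rp]] Ar <-]]; exact: rp.
  have Btot q r : B q -> B r ->
      (forall x, q x <= r x) \/ (forall x, r x <= q x).
    move=> Bq; case=> [->|[r' Ar' <-]]; first by left=> x; exact: Ble.
    case: Bq => [->|[q' Aq' <-]]; first by right=> x; apply: (proj2 (svalP r')).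
    by have [/asboolP|/asboolP] := chainA _ _ Aq' Ar'; [right|left].
  pose m x := inf [set q x | q in B].
  have mlb x : has_lbound [set q x | q in B].
    exists (- p (- x)) => _ [q Bq <-].
    by rewrite (le_trans _ (sublinearN_ge x (Bsub _ Bq)))// lerN2 Ble.
  have m_le q x : B q -> m x <= q x by move=> Bq; apply: ge_inf => //; exists q.
  have m_ge c x : (forall q, B q -> c <= q x) -> c <= m x.
    move=> h; apply: lb_le_inf; first by exists (p x), p.
    by move=> _ [q Bq <-]; exact: h.
  have hm : sublinear m.
    split=> [x y|t x t0].
      rewrite -lerBlDr; apply/m_ge => q Bq.
      rewrite lerBlDr -lerBlDl; apply/m_ge => r Br; rewrite lerBlDl.
      (* The smaller of [q] and [r] estimates both terms. *)
      have [qr|rq] := Btot _ _ Bq Br.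
        rewrite (le_trans (m_le q _ Bq))//.
        rewrite (le_trans (sublinearD (Bsub _ Bq) _ _))//.
        by rewrite lerD2l.
      rewrite (le_trans (m_le r _ Br))//.
      rewrite (le_trans (sublinearD (Bsub _ Br) _ _))//.
      by rewrite lerD2r.
    have [->|tn0] := eqVneq t 0.
      by rewrite scale0r mul0r (le_trans (m_le _ _ Bp))// sublinear0.
    have tp : 0 < t by rewrite lt_def tn0.
    rewrite -ler_pdivrMl//; apply/m_ge => q Bq; rewrite ler_pdivrMl//.
    by rewrite (le_trans (m_le _ _ Bq))// (sublinearZ_le (Bsub _ Bq)).
  have mp x : m x <= p x by exact: m_le.
  exists (exist _ m (conj hm mp)) => q Aq; apply/asboolP => x /=.
  by apply: m_le; right; exists q.
exists q; split=> // r hr rq.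
have rp x : r x <= p x by exact: le_trans (rq x) (qp x).
have /qmin : le (exist _ q (conj hq qp)) (exist _ r (conj hr rp)).
  exact/asboolP.
by case.
Qed.

Lemma minimal_sublinear_additive q : sublinear q ->
  (forall r, sublinear r -> (forall x, r x <= q x) -> r = q) ->
  forall x y, q (x + y) = q x + q y.
Proof.
move=> hq qmin x y; apply/eqP; rewrite eq_le (sublinearD hq)/=.
have qy := qmin _ (contract_sublinear hq y) (contract_le hq y).
have := contract_le_shift hq y x ler01.
by rewrite qy scale1r mul1r lerBrDr.
Qed.

(** The minimal functional is taken below [contract p x0] rather than [p]: then
    [q (- x0) <= - p x0], which forces equality at [x0]. *)
Lemma hahn_banach_real p x0 : sublinear p ->
  exists q, [/\ forall x y, q (x + y) = q x + q y,
    forall t x, q (t%:C *: x) = t * q x,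
    forall x, q x <= p x & q x0 = p x0].
Proof.
move=> hp.
have [q [hq qp qmin]] := minimal_sublinear (contract_sublinear hp x0).
have qD := minimal_sublinear_additive hq qmin.
have qN x : q (- x) = - q x.
  by apply/eqP; rewrite -addr_eq0 -qD addNr sublinear0.
have qlep x : q x <= p x by exact: le_trans (qp x) (contract_le hp x0 x).
exists q; split=> // [t x|].
  have [t0|/ltW t0] := leP 0 t; first exact: sublinearZ.
  rewrite -{1}[t]opprK rmorphN scaleNr qN (sublinearZ _ hq) ?oppr_ge0//.
  by rewrite mulNr opprK.
apply/eqP; rewrite eq_le qlep/= -lerN2 -qN.
exact: le_trans (qp _) (contractN hp x0).
Qed.

Lemma rnorm_ge_Re (z : R[i]^o) : complex.Re z <= rnorm z.
Proof.
rewrite -lecR rnormE (le_trans _ (normc_ge_Re z))// lecR.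
exact: ler_norm.
Qed.

(** Serves to turn a sum of moduli into the value of one functional at a unimodular combination. *)
Lemma rotate_to_norm (z : R[i]^o) :
  exists u : R[i], `|u| = 1 /\ u * z = (rnorm z)%:C.
Proof.
have [->|z0] := eqVneq z 0; first by exists 1; rewrite normr1 mulr0 rnorm0.
have nz0 : `|z| != 0 by rewrite normr_eq0.
exists (`|z| / z); rewrite normf_div normr_id divff//; split=> //.
by rewrite divfK// rnormE.
Qed.

Lemma hahn_banach p x0 : is_norm p ->
  exists f : V -> R[i]^o,
    [/\ linear f, forall x, rnorm (f x) <= p x & p x0 <= rnorm (f x0)].
Proof.
move=> hp.
have subp : sublinear p.
  split=> [|t x t0]; first exact: is_normD.
  by rewrite (is_normZ hp) ger0_norm ?lecR.
have [q [qD qZ qp qx0]] := hahn_banach_real x0 subp.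
(* The complex-linear functional with real part [q]. *)
pose f (x : V) : R[i]^o := (q x)%:C - 'i * (q ('i *: x))%:C.
have ref x : complex.Re (f x) = q x.
  by rewrite /f /= !(mul0r, mul1r, mulr0, subr0, oppr0, addr0).
have fD x y : f (x + y) = f x + f y.
  by rewrite /f scalerDr !qD !rmorphD/= mulrDr opprD addrACA.
have fR t x : f (t%:C *: x) = t%:C * f x.
  rewrite /f scalerA [_ * t%:C]mulrC -scalerA !qZ !rmorphM/=.
  by rewrite mulrBr mulrCA.
have fi x : f ('i *: x) = 'i * f x.
  have qN y : q (- y) = - q y.
    have := qZ (-1) y; rewrite rmorphN rmorph1 scaleN1r => ->.
    by rewrite mulN1r.
  rewrite /f scalerA -expr2 sqr_i scaleN1r qN mulrBr mulrA -expr2 sqr_i.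
  by rewrite rmorphN/= mulrN mulN1r !opprK addrC.
have fZ a x : f (a *: x) = a * f x.
  rewrite {1}[a]complexE scalerDl fD fR -scalerA fi fR.
  by rewrite mulrA -mulrDl -complexE.
exists f; split=> [a x y|x|]; first by rewrite fD fZ.
  (* A rotation makes [f (u *: x)] real, hence equal to [q (u *: x)], and [p] is invariant under
     rotations. *)
  have [u [u1 ufx]] := rotate_to_norm (f x).
  have -> : rnorm (f x) = q (u *: x) by rewrite -ref fZ ufx.
  by rewrite (le_trans (qp _))// (is_normZ hp) u1 mul1r.
by rewrite -qx0 -ref rnorm_ge_Re.
Qed.

End HahnBanach.

(** * Families of functionals with [mu1 l <= 1] *)

Section Topdual.
Variables (R : realType) (E : normedModType R[i]).
Implicit Types (x y : E) (f g : topdual E).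

Lemma rnormM (a b : R[i]^o) : rnorm (a * b : R[i]^o) = rnorm a * rnorm b.
Proof. exact: (rnormZ a b). Qed.

Lemma rnorm_unit (u : R[i]) (x : E) : `|u| = 1 -> rnorm (u *: x) = rnorm x.
Proof. by move=> u1; rewrite rnormZ /rnorm u1 mul1r. Qed.

Lemma rnorm_real (t : R) : 0 <= t -> rnorm (t%:C : R[i]^o) = t.
Proof. by move=> t0; rewrite /rnorm ger0_norm ?lecR. Qed.

Lemma rnorm_sum (F : normedModType R[i]) I (r : seq I) (P : pred I)
    (x : I -> F) :
  rnorm (\sum_(i <- r | P i) x i) <= \sum_(i <- r | P i) rnorm (x i).
Proof.
elim/big_ind2 : _ => // [|x1 s1 x2 s2 h1 h2]; first by rewrite rnorm0.
exact: le_trans (rnormD _ _) (lerD h1 h2).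
Qed.

Lemma topdual_sum I (r : seq I) (P : pred I) (F : I -> topdual E) x :
  (\sum_(i <- r | P i) F i) x = \sum_(i <- r | P i) F i x.
Proof. by elim/big_ind2 : _ => // f a g b <- <-. Qed.

Lemma rnorm_topdual_apply f x : rnorm (f x) <= rnorm f * rnorm x.
Proof.
have [->|x0] := eqVneq x 0; first by rewrite linear0 !rnorm0 mulr0.
have nx0 : 0 < rnorm x by rewrite -ltcR rnormE normr_gt0.
have inv0 : 0 <= (rnorm x)^-1 by rewrite invr_ge0 ltW.
have : rnorm (f ((rnorm x)^-1%:C *: x)) <= rnorm f.
  rewrite rnorm_topdual opnorm_ge// rnormZ rnorm_real//.
  by rewrite mulVf// gt_eqF.
by rewrite linearZ/= rnormZ rnorm_real// ler_pdivrMl// mulrC.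
Qed.

Lemma bounded_functional (f : E -> R[i]^o) (c : R) : linear f ->
  (forall x, rnorm (f x) <= c * rnorm x) ->
  exists g : topdual E, dual_fun g = f.
Proof.
move=> lf fc.
pose F : {linear E -> R[i]^o} := HB.pack f (GRing.isLinear.Build _ _ _ _ f lf).
suff cf : continuous F.
  have hf : f \in @is_functional R E by apply/is_functionalP.
  by exists (Topdual hf).
apply/linear_bounded_continuous/linear_boundedP.
exists c%:C; split=> [|M cM x]; first by apply/complex_realP; exists c.
rewrite -!rnormE.
rewrite (@le_trans _ _ (c%:C * (rnorm x)%:C))//.
  by rewrite -rmorphM lecR fc.
by rewrite ler_wpM2r ?lecR ?rnorm_ge0// ltW.
Qed.

End Topdual.

Section SummingBall.
Variables (R : realType) (E : normedModType R[i]) (n : nat).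
Implicit Types (x : E) (l : 'I_n -> topdual E).

(* [mu1 l <= 1] tested on the evaluations at [x] only instead of on the whole
   unit ball of the bidual. *)
Definition summing_ball l : Prop :=
  forall x, rnorm x <= 1 -> \sum_(j < n) rnorm (l j x) <= 1.

(** The canonical map of [E] into its bidual. *)
Lemma evaluation_functional x :
  exists g : topdual (topdual E), forall f : topdual E, g f = f x.
Proof.
pose ev (f : topdual E) : R[i]^o := f x.
have [] := @bounded_functional R (topdual E) ev (rnorm x).
- by move=> a f g.
- by move=> f; rewrite mulrC rnorm_topdual_apply.
by move=> g gE; exists g => f; rewrite gE.
Qed.

Lemma mu1_le1_summing_ball l : (mu1 l <= 1)%E -> summing_ball l.
Proof.
move=> l1 x x1; have [g gE] := evaluation_functional x.
rewrite -lee_fin (le_trans _ l1)//; apply: ereal_sup_ubound.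
exists g => /=; last by congr _%:E; apply: eq_bigr => j _; rewrite gE.
rewrite rnorm_topdual opnorm_le// => f f1; rewrite gE.
rewrite (le_trans (rnorm_topdual_apply f x))//.
by rewrite mulr_ile1 ?rnorm_ge0.
Qed.

Lemma summing_ball_torus l : summing_ball l ->
  forall zeta, torus R n zeta -> rnorm (\sum_(j < n) zeta j *: l j) <= 1.
Proof.
move=> l1 zeta z1; rewrite rnorm_topdual opnorm_le// => x x1.
rewrite topdual_sum (le_trans (rnorm_sum _ _ _))// (le_trans _ (l1 x x1))//.
by apply: ler_sum => j _; rewrite topdualZE rnorm_unit.
Qed.

(** Rotating each [g (l j)] to its modulus turns the sum of moduli into the value of [g] at a
    unimodular combination of the [l j]. This closes the cycle of implications between the three
    conditions on [l]. *)
Lemma torus_mu1_le1 l :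
  (forall zeta, torus R n zeta -> rnorm (\sum_(j < n) zeta j *: l j) <= 1) ->
  (mu1 l <= 1)%E.
Proof.
move=> l1; apply: ge_ereal_sup => _ [g /= g1 <-]; rewrite lee_fin.
have /choice[zeta zetaP] := fun j => rotate_to_norm (g (l j)).
have z1 : torus R n zeta by move=> j; case: (zetaP j).
have sum0 : 0 <= \sum_(j < n) rnorm (g (l j)).
  by apply: sumr_ge0 => j _; exact: rnorm_ge0.
rewrite -(rnorm_real sum0) rmorph_sum/=.
have -> : \sum_(j < n) (rnorm (g (l j)))%:C = g (\sum_(j < n) zeta j *: l j).
  rewrite linear_sum; apply: eq_bigr => j _.
  by rewrite linearZ/=; case: (zetaP j).
rewrite (le_trans (rnorm_topdual_apply g _))//.
by rewrite mulr_ile1 ?rnorm_ge0 ?l1.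
Qed.

Lemma mu1_le1E l : (mu1 l <= 1)%E <-> summing_ball l.
Proof.
split; first exact: mu1_le1_summing_ball.
by move=> /summing_ball_torus; exact: torus_mu1_le1.
Qed.

Lemma mu1_le1_torusE l : (mu1 l <= 1)%E <->
  forall zeta, torus R n zeta -> rnorm (\sum_(j < n) zeta j *: l j) <= 1.
Proof.
split; last exact: torus_mu1_le1.
by move=> /mu1_le1_summing_ball; exact: summing_ball_torus.
Qed.

Lemma summing_ball_rnorm l j : summing_ball l -> rnorm (l j) <= 1.
Proof.
move=> l1; rewrite rnorm_topdual opnorm_le// => x /l1; apply: le_trans.
rewrite (bigD1 j)//= lerDl; apply: sumr_ge0 => i _; exact: rnorm_ge0.
Qed.

Lemma summing_ball0 : summing_ball (fun=> 0).
Proof.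
move=> x _; rewrite big1 ?ler01// => j _.
by rewrite [X in rnorm X](_ : _ = 0)// rnorm0.
Qed.

End SummingBall.

(** * The dual formula defines a multi-norm *)

Section DualNorm.
Variables (R : realType) (E : normedModType R[i]).

Lemma rnorm_dual_norming (x : E) :
  exists2 g : topdual E, rnorm g <= 1 & rnorm x <= rnorm (g x).
Proof.
have hp : is_norm (@rnorm R E).
  by split; [exact: rnormD|exact: rnormZ|exact: rnorm0_eq0].
have [f [lf fle fx]] := hahn_banach x hp.
have [g gE] : exists g : topdual E, dual_fun g = f.
  by apply: (@bounded_functional _ _ _ 1) => // y; rewrite mul1r.
exists g; last by rewrite gE.
rewrite rnorm_topdual opnorm_le// => y; rewrite gE; exact: le_trans.
Qed.

Definition dualnorm k (x : 'I_k -> E) : R :=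
  sup [set rnorm (\sum_(j < k) l j (x j)) | l in [set l | summing_ball l]].

Lemma rnorm_pairing_le k (x : 'I_k -> E) (l : 'I_k -> topdual E) :
  (forall j, rnorm (l j) <= 1) ->
  rnorm (\sum_(j < k) l j (x j)) <= \sum_(j < k) rnorm (x j).
Proof.
move=> l1; rewrite (le_trans (rnorm_sum _ _ _))// ler_sum// => j _.
rewrite (le_trans (rnorm_topdual_apply _ _))//.
by rewrite ler_piMl ?rnorm_ge0.
Qed.

Lemma dualnorm_ge k (x : 'I_k -> E) l :
  summing_ball l -> rnorm (\sum_(j < k) l j (x j)) <= dualnorm x.
Proof.
move=> l1; apply: ub_le_sup; last by exists l.
(* The supremum is finite because every [l j] has norm at most 1. *)
exists (\sum_(j < k) rnorm (x j)) => _ [l' l'1 <-].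
by rewrite rnorm_pairing_le// => j; exact: summing_ball_rnorm.
Qed.

Lemma dualnorm_le k (x : 'I_k -> E) (c : R) :
  (forall l, summing_ball l -> rnorm (\sum_(j < k) l j (x j)) <= c) ->
  dualnorm x <= c.
Proof.
move=> h; apply: ge_sup; last by move=> _ [l l1 <-]; exact: h.
exists (rnorm (\sum_(j < k) (0 : topdual E) (x j))), (fun=> 0) => //.
exact: summing_ball0.
Qed.

Lemma dualnorm_ge0 k (x : 'I_k -> E) : 0 <= dualnorm x.
Proof.
exact: le_trans (rnorm_ge0 _) (dualnorm_ge x (@summing_ball0 _ _ _)).
Qed.

Lemma dualnormZ_le k (x : 'I_k -> E) (a : R[i]) :
  dualnorm (a *: x) <= rnorm (a : R[i]^o) * dualnorm x.
Proof.
apply: dualnorm_le => l l1.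
under eq_bigr do rewrite [(a *: x) _]/(a *: x _) linearZ/=.
by rewrite -scaler_sumr rnormZ ler_wpM2l ?rnorm_ge0 ?dualnorm_ge.
Qed.

Lemma dualnorm0 k : dualnorm (0 : 'I_k -> E) = 0.
Proof.
apply/eqP; rewrite eq_le dualnorm_ge0 andbT.
by have := dualnormZ_le (0 : 'I_k -> E) 0; rewrite scale0r rnorm0 mul0r.
Qed.

(* Taking for [s] permutations, inclusions and collapsing maps yields all of
   (A1)-(A4). *)
Lemma dualnorm_reindex_le m k (s : 'I_m -> 'I_k) (a : 'I_m -> R[i])
    (x : 'I_k -> E) (c : R) :
  0 <= c -> (forall i, rnorm (a i : R[i]^o) <= c) ->
  dualnorm (fun i => a i *: x (s i)) <= c * dualnorm x.
Proof.
move=> c0 ac; have [cE|cn0] := eqVneq c 0.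
  rewrite (_ : (fun i => _) = 0) ?dualnorm0 ?mulr_ge0 ?dualnorm_ge0//.
  apply/funext => i; have := ac i; rewrite cE => ai.
  suff /rnorm0_eq0 -> : rnorm (a i : R[i]^o) = 0 by rewrite scale0r.
  by apply/eqP; rewrite eq_le ai rnorm_ge0.
have cp : 0 < c by rewrite lt_def cn0.
apply: dualnorm_le => l l1; rewrite -ler_pdivrMl//.
(* The transposed family: [l' j] collects the rescaled [l i] over the fibre of [s] at [j]. It stays
   in the ball since the factors have modulus at most 1. *)
pose l' (j : 'I_k) : topdual E :=
  \sum_(i < m | s i == j) (c^-1%:C * a i) *: l i.
have l'1 : summing_ball l'.
  move=> y y1; rewrite (le_trans _ (l1 y y1))//.
  rewrite (partition_big s xpredT)//=; apply: ler_sum => j _.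
  rewrite topdual_sum (le_trans (rnorm_sum _ _ _))//; apply: ler_sum => i _.
  rewrite topdualZE rnormZ ler_piMl ?rnorm_ge0// rnormM rnorm_real ?invr_ge0//.
  by rewrite ler_pdivrMl// mulr1.
rewrite (le_trans _ (dualnorm_ge x l'1))//.
have -> : \sum_(j < k) l' j (x j) =
    c^-1%:C *: \sum_(i < m) l i (a i *: x (s i)).
  rewrite (partition_big s xpredT)//= scaler_sumr; apply: eq_bigr => j _.
  rewrite topdual_sum scaler_sumr; apply: eq_bigr => i /eqP <-.
  by rewrite topdualZE linearZ/= scalerA.
by rewrite rnormZ rnorm_real ?invr_ge0.
Qed.

Lemma dualnorm_reindex1_le m k (s : 'I_m -> 'I_k) (x : 'I_k -> E) :
  dualnorm (x \o s) <= dualnorm x.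
Proof.
rewrite -[leRHS]mul1r.
rewrite (le_trans _ (@dualnorm_reindex_le _ _ s (fun=> 1) x 1 _ _))//.
  by rewrite (_ : (fun i => _) = x \o s)//; apply/funext => i; rewrite scale1r.
by move=> i; rewrite (rnorm_real ler01).
Qed.

Lemma dualnorm_is_norm k : is_norm (@dualnorm k).
Proof.
split=> [x y|a x|x x0].
- apply: dualnorm_le => l l1.
  under eq_bigr do rewrite [(x + y) _]/(x _ + y _) linearD/=.
  by rewrite big_split (le_trans (rnormD _ _))// lerD// dualnorm_ge.
- apply/eqP; rewrite eq_le; apply/andP; split; first exact: dualnormZ_le.
  rewrite -/(rnorm (a : R[i]^o)).
  have [->|a0] := eqVneq a 0.
    by rewrite rnorm0 mul0r dualnorm_ge0.
  have na0 : 0 < rnorm (a : R[i]^o) by rewrite -ltcR rnormE normr_gt0.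
  rewrite -ler_pdivlMl// -[X in dualnorm X](scalerK a0).
  rewrite (le_trans (dualnormZ_le _ _))// ler_wpM2r ?dualnorm_ge0//.
  by rewrite -lecR rnormE normfV fmorphV/= rnormE.
- apply/funext => i; apply: rnorm0_eq0; apply/eqP.
  rewrite eq_le rnorm_ge0 andbT.
  have [g g1 gx] := rnorm_dual_norming (x i).
  (* A norming functional of [x i] in place [i] and zeros elsewhere detects [x i]. *)
  pose l (j : 'I_k) : topdual E := if j == i then g else 0.
  have l1 : summing_ball l.
    move=> y y1; rewrite (bigD1 i)//= big1 => [|j /negPf ji].
      rewrite /l eqxx addr0 (le_trans (rnorm_topdual_apply _ _))//.
      by rewrite mulr_ile1 ?rnorm_ge0.
    by rewrite /l ji [X in rnorm X](_ : _ = 0)// rnorm0.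
  rewrite -x0 (le_trans _ (dualnorm_ge x l1))//.
  rewrite (bigD1 i)//= big1 => [|j /negPf ji]; first by rewrite /l eqxx addr0.
  by rewrite /l ji.
Qed.

Lemma dualnorm1 (x : E) : dualnorm (fun _ : 'I_1 => x) = rnorm x.
Proof.
apply/eqP; rewrite eq_le; apply/andP; split.
  apply: dualnorm_le => l l1.
  rewrite (le_trans (rnorm_pairing_le _ _))?big_ord1// => j.
  exact: summing_ball_rnorm.
have [g g1 gx] := rnorm_dual_norming x.
have l1 : summing_ball (fun _ : 'I_1 => g).
  move=> y y1; rewrite big_ord1 (le_trans (rnorm_topdual_apply _ _))//.
  by rewrite mulr_ile1 ?rnorm_ge0.
by rewrite (le_trans gx)// (le_trans _ (dualnorm_ge _ l1))// big_ord1.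
Qed.

Lemma append_max k (x : 'I_k -> E) y : append x y ord_max = y.
Proof. by rewrite /append unlift_none. Qed.

Lemma append_lift k (x : 'I_k -> E) y i : append x y (lift ord_max i) = x i.
Proof. by rewrite /append liftK. Qed.

Lemma ordS_lastP k (P : 'I_k.+1 -> Prop) :
  P ord_max -> (forall i, P (lift ord_max i)) -> forall i, P i.
Proof. by move=> Pm Pl i; case: (unliftP ord_max i) => [j|] ->. Qed.

Lemma dualnorm_multinorm : multinorm dualnorm.
Proof.
split=> [k|x|k s x|k a x|k x|k x].
- exact: dualnorm_is_norm.
- exact: dualnorm1.
- apply/eqP; rewrite eq_le dualnorm_reindex1_le/=.
  rewrite [X in dualnorm X <= _](_ : _ = (x \o s) \o (s^-1)%g).
    exact: dualnorm_reindex1_le.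
  by apply/funext => i /=; rewrite permKV.
- apply: (@dualnorm_reindex_le _ _ id); first exact: bigmax_ge_id.
  by move=> i; exact: le_bigmax.
- apply/eqP; rewrite eq_le; apply/andP; split.
    (* The value [ord0] at the last index is arbitrary, since [a] vanishes there. *)
    pose s (i : 'I_k.+2) : 'I_k.+1 := odflt ord0 (unlift ord_max i).
    pose a (i : 'I_k.+2) : R[i] := (unlift ord_max i != None)%:R.
    have -> : append x 0 = fun i => a i *: x (s i).
      apply/funext; apply: ordS_lastP => [|i].
        by rewrite append_max /a unlift_none scale0r.
      by rewrite append_lift /a /s liftK/= scale1r.
    rewrite -[leRHS]mul1r dualnorm_reindex_le// => i.
    rewrite /a; case: (_ != _); first by rewrite (rnorm_real ler01).
    by rewrite rnorm0.
  rewrite [X in dualnorm X <= _](_ : _ = append x 0 \o lift ord_max).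
    exact: dualnorm_reindex1_le.
  by apply/funext => i /=; rewrite append_lift.
- apply/eqP; rewrite eq_le; apply/andP; split.
    (* Here the default [ord_max] matters: the last index is collapsed onto the one before it. *)
    pose s (i : 'I_k.+2) : 'I_k.+1 := odflt ord_max (unlift ord_max i).
    rewrite (_ : append _ _ = x \o s) ?dualnorm_reindex1_le//.
    apply/funext; apply: ordS_lastP => [|i].
      by rewrite append_max /s /= unlift_none.
    by rewrite append_lift /s /= liftK.
  rewrite [X in dualnorm X <= _](_ :
    _ = append x (x ord_max) \o lift ord_max).
    exact: dualnorm_reindex1_le.
  by apply/funext => i /=; rewrite append_lift.
Qed.

End DualNorm.

(** * Upper bound for an arbitrary multi-norm *)

Section MultinormBound.
Variables (R : realType) (E : normedModType R[i]).
Variables (N : forall k, ('I_k -> E) -> R) (hN : multinorm N).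

(** (A4) removes the repeated entries one at a time. *)
Lemma multinorm_diag k (y : E) : N (fun _ : 'I_k.+1 => y) = rnorm y.
Proof.
elim: k => [|k <-]; first exact: multinorm1.
rewrite -[RHS](multinormA4 hN); apply/(congr1 (@N k.+2))/funext.
by apply: ordS_lastP => [|i]; rewrite (append_max, append_lift).
Qed.

Lemma multinorm_scaled_diag_le k (a : 'I_k.+1 -> R[i]) (y : E) :
  (forall i, rnorm (a i : R[i]^o) <= 1) -> N (fun i => a i *: y) <= rnorm y.
Proof.
(* (A2) is stated from length 2 on; length 1 uses homogeneity of the norm of [E]. *)
case: k a => [|k] a a1.
  rewrite (_ : (fun i => _) = fun=> a ord0 *: y); last first.
    by apply/funext => i; rewrite (ord1 i).
  by rewrite multinorm_diag rnormZ ler_piMl ?rnorm_ge0.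
rewrite (le_trans (multinormA2 hN _ _))// multinorm_diag ler_piMl ?rnorm_ge0//.
by apply: bigmax_le => // i _; exact: a1.
Qed.

(* A norming functional [f] for [N x] on [E^n] splits into coordinates [l j];
   for unimodular [zeta], [\sum_j zeta j * l j y] is the value of [f] at
   [(zeta j *: y)_j], whose norm is at most that of [y]. *)
Lemma multinorm_le_summing k (x : 'I_k.+1 -> E) :
  (forall j, rnorm (x j) <= 1) ->
  exists2 l : 'I_k.+1 -> topdual E, summing_ball l &
    N x <= \sum_(j < k.+1) rnorm (l j).
Proof.
move=> x1.
have [f [lf fle fx]] := hahn_banach x (multinorm_norm hN k).
pose F : {linear ('I_k.+1 -> E) -> R[i]^o} :=
  HB.pack f (GRing.isLinear.Build _ _ _ _ f lf).
(* The embedding of coordinate [j], written as a scaled diagonal so that [multinorm_scaled_diag_le]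
   bounds it. *)
pose e (j : 'I_k.+1) (y : E) : 'I_k.+1 -> E :=
  fun i => ((i == j)%:R : R[i]) *: y.
have eD j a y z : e j (a *: y + z) = a *: e j y + e j z.
  apply/funext => i; rewrite -[RHS]/(a *: e j y i + e j z i).
  rewrite /e scalerDr !scalerA.
  by rewrite mulrC.
have sum_e (v : 'I_k.+1 -> E) : v = \sum_(j < k.+1) e j (v j).
  apply/funext => i; rewrite fct_sumE (bigD1 i)//= big1 => [|j /negPf ji].
    by rewrite /e eqxx scale1r addr0.
  by rewrite /e eq_sym ji scale0r.
have /choice[l lE] : forall j, exists g : topdual E, dual_fun g = F \o e j.
  move=> j; apply: (@bounded_functional _ _ _ 1) => [a y z|y] /=.
    by rewrite eD lf.
  rewrite mul1r (le_trans (fle _))// multinorm_scaled_diag_le// => i.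
  by case: (_ == _); rewrite ?rnorm0 ?(rnorm_real ler01).
exists l.
  move=> y y1.
  have /choice[zeta zetaP] := fun j => rotate_to_norm (l j y).
  have sum0 : 0 <= \sum_(j < k.+1) rnorm (l j y).
    by apply: sumr_ge0 => j _; exact: rnorm_ge0.
  rewrite -(rnorm_real sum0) rmorph_sum/=.
  have -> : \sum_(j < k.+1) (rnorm (l j y))%:C = F (fun j => zeta j *: y).
    rewrite [X in F X]sum_e linear_sum; apply: eq_bigr => j _.
    by case: (zetaP j) => _ <-; rewrite -[RHS]/((F \o e j) _) -lE linearZ.
  rewrite (le_trans (fle _))// (le_trans _ y1)//.
  apply: multinorm_scaled_diag_le => // j.
  by rewrite /rnorm; case: (zetaP j) => -> _.
rewrite (le_trans fx)// -[f x]/(F x) [X in F X]sum_e linear_sum.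
rewrite (le_trans (rnorm_sum _ _ _))// ler_sum// => j _.
rewrite -[X in rnorm X]/((F \o e j) _) -lE.
by rewrite (le_trans (rnorm_topdual_apply _ _))// ler_piMr ?rnorm_ge0.
Qed.

End MultinormBound.

(** * The constants *)

Section PhiMax.
Variables (R : realType) (E : normedModType R[i]).

(** The norm of [g] need not be attained, hence the slack [e]; a rotation makes the value at [x]
    real and nonnegative, so that such values add up without cancellation. *)
Lemma topdual_almost_norming (g : topdual E) (e : R) : 0 < e ->
  exists x : E,
    [/\ rnorm x <= 1, g x = (rnorm (g x))%:C & rnorm g - e <= rnorm (g x)].
Proof.
move=> e0.
have [x x1 gx] : exists2 x : E, rnorm x <= 1 & rnorm g - e <= rnorm (g x).
  apply: contrapT => h.
  suff : rnorm g <= rnorm g - e by rewrite lerBrDl gerDr leNgt e0.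
  rewrite {1}rnorm_topdual opnorm_le// => x x1.
  by rewrite leNgt; apply/negP => /ltW gx; apply: h; exists x.
have [u [u1 ug]] := rotate_to_norm (g x).
have gu : rnorm (g (u *: x)) = rnorm (g x) by rewrite linearZ rnorm_unit.
by exists (u *: x); rewrite gu rnorm_unit//; split=> //; rewrite linearZ.
Qed.

Lemma summing_le_phi_max k (l : 'I_k -> topdual E) : summing_ball l ->
  ((\sum_(j < k) rnorm (l j))%:E <= phi_max E k)%E.
Proof.
move=> l1; apply/lee_addgt0Pr => e e0.
(* The [k] errors [d] total at most [e]; the denominator [k.+1] also covers [k = 0]. *)
pose d := e / k.+1%:R.
have d0 : 0 < d by rewrite divr_gt0.
have /choice[x xP] := fun j => topdual_almost_norming (l j) d0.
have : ((dualnorm x)%:E <= phi_max E k)%E.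
  rewrite (@le_trans _ _ (max_multinorm x))//.
    by apply: ereal_sup_ubound; exists (@dualnorm R E) => //;
      exact: dualnorm_multinorm.
  by apply: ereal_sup_ubound; exists x => // j; case: (xP j).
rewrite -(leeD2rE _ _ (_ : e%:E \is a fin_num))//; apply: le_trans.
rewrite -EFinD lee_fin -lerBlDr (le_trans _ (dualnorm_ge x l1))//.
have sum0 : 0 <= \sum_(j < k) rnorm (l j (x j)).
  by apply: sumr_ge0 => j _; exact: rnorm_ge0.
have -> : \sum_(j < k) l j (x j) = (\sum_(j < k) rnorm (l j (x j)))%:C.
  by rewrite rmorph_sum; apply: eq_bigr => j _; case: (xP j).
rewrite rnorm_real//.
rewrite (@le_trans _ _ (\sum_(j < k) (rnorm (l j) - d)))//; last first.
  by apply: ler_sum => j _; case: (xP j).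
rewrite sumrB lerD2l lerN2 sumr_const card_ord /d -[_ *+ k]mulr_natr mulrAC.
by rewrite ler_pdivrMr// ler_pM2l// ler_nat.
Qed.

Lemma phi_max_summingE k : (0 < k)%N ->
  phi_max E k = ereal_sup [set (\sum_(j < k) rnorm (l j))%:E
                          | l in [set l : 'I_k -> topdual E | (mu1 l <= 1)%E]].
Proof.
(* Length 0 is excluded because a multi-norm leaves [N 0] arbitrary. *)
case: k => // k _; apply/eqP; rewrite eq_le; apply/andP; split.
  apply: ge_ereal_sup => _ [x /= x1 <-]; apply: ge_ereal_sup => _ [N hN <-].
  have [l l1 Nl] := multinorm_le_summing hN x1.
  rewrite (@le_trans _ _ (\sum_(j < k.+1) rnorm (l j))%:E) ?lee_fin//.
  by apply: ereal_sup_ubound; exists l => //=; exact/mu1_le1E.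
apply: ge_ereal_sup => _ [l /= /mu1_le1E l1 <-].
exact: summing_le_phi_max.
Qed.

End PhiMax.

(** * The lower bound by [n / c_n] *)

Section PiC.
Variables (R : realType) (F : normedModType R[i]).

Lemma pi1_ge0 n : (0 <= pi1 F n)%E.
Proof.
apply: ereal_sup_ge; exists 0%E => //.
exists (fun=> 0); last by rewrite big1// => j _; rewrite rnorm0.
apply: ge_ereal_sup => _ [g _ <-]; rewrite lee_fin big1 ?ler01// => j _.
by rewrite linear0 rnorm0.
Qed.
End PiC.

Section PiDual.
Variables (R : realType) (E : normedModType R[i]) (n : nat).

(** The family [x j / r] satisfies the torus form of [mu1 <= 1], and its norms sum to [n / r]. *)
Lemma pi1_ge_div (x : 'I_n -> topdual E) (r : R) :
  (forall j, rnorm (x j) = 1) -> 0 < r ->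
  (forall zeta, torus R n zeta -> rnorm (\sum_(j < n) zeta j *: x j) <= r) ->
  ((n%:R / r)%:E <= pi1 (topdual E) n)%E.
Proof.
move=> x1 r0 xr; have ir0 : 0 <= r^-1 by rewrite invr_ge0 ltW.
apply: ereal_sup_ubound; exists (fun j => r^-1%:C *: x j) => /=.
  apply/mu1_le1_torusE => zeta z1.
  under eq_bigr do rewrite scalerA mulrC -scalerA.
  rewrite -scaler_sumr rnormZ rnorm_real// ler_pdivrMl// mulr1.
  exact: xr.
congr _%:E; under eq_bigr do rewrite rnormZ rnorm_real// x1 mulr1.
by rewrite sumr_const card_ord mulr_natl.
Qed.

Lemma pi1_ge_cconst : (0 < n)%N ->
  (n%:R%:E / cconst (topdual E) n <= pi1 (topdual E) n)%E.
Proof.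
move=> n0; have [->|pioo] := eqVneq (pi1 (topdual E) n) +oo%E.
  by rewrite leey.
have pifin : pi1 (topdual E) n \is a fin_num.
  by rewrite ge0_fin_numE ?pi1_ge0// ltey.
pose p := fine (pi1 (topdual E) n).
have pE : pi1 (topdual E) n = p%:E by rewrite fineK.
have nR : 0 < n%:R :> R by rewrite ltr0n.
pose X := [set x : 'I_n -> topdual E | forall j, rnorm (x j) = 1].
(* Without unit vectors the infimum is [+oo] and the quotient is 0. *)
have [X0|/set0P[x0 Xx0]] := eqVneq X set0.
  by rewrite /cconst -/X X0 image_set0 ereal_inf0 invey mule0 pi1_ge0.
have p_div (x : 'I_n -> topdual E) (r : R) : X x -> 0 < r ->
    (forall zeta, torus R n zeta -> rnorm (\sum_(j < n) zeta j *: x j) <= r) ->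
    n%:R <= p * r.
  move=> Xx r0 xr; rewrite -ler_pdivrMr// -lee_fin -pE.
  exact: (pi1_ge_div Xx r0 xr).
(* By the triangle inequality [r = n] is an admissible bound for unit vectors. *)
have p0 : 0 < p.
  have : n%:R <= p * n%:R.
    apply: (p_div x0) => // zeta z1.
    rewrite (le_trans (rnorm_sum _ _ _))//.
    under eq_bigr do rewrite rnorm_unit// Xx0.
    by rewrite sumr_const card_ord.
  by rewrite ler_pMl//; exact: lt_le_trans.
have c_ge : ((n%:R / p)%:E <= cconst (topdual E) n)%E.
  apply: le_ereal_inf_tmp => _ [x Xx <-].
  set S := ereal_sup _.
  have S_ge zeta : torus R n zeta ->
      ((rnorm (\sum_(j < n) zeta j *: x j))%:E <= S)%E.
    by move=> z1; apply: ereal_sup_ubound; exists zeta.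
  have S0 : (0 <= S)%E.
    rewrite (le_trans _ (S_ge (fun=> 1) _)) ?lee_fin ?rnorm_ge0// => j.
    by rewrite normr1.
  case: S S_ge S0 => [s|_ _|//]; last by rewrite leey.
  (* [p_div] requires a positive bound and only [0 <= s] is known, so it is applied to [s + e]. *)
  move=> s_ge; rewrite lee_fin => s0; apply/lee_addgt0Pr => e e0.
  rewrite -EFinD lee_fin ler_pdivrMr// mulrC.
  apply: (p_div x) => //; first by rewrite ltr_wpDl.
  by move=> zeta /s_ge; rewrite lee_fin => /le_trans; apply; rewrite lerDl ltW.
(* It remains to invert [n / p <= c_n]; an infinite [c_n] gives the quotient 0. *)
rewrite pE; case: (cconst _ _) c_ge => [c|_|//]; last first.
  by rewrite invey mule0 lee_fin ltW.
rewrite lee_fin => c_ge.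
have c0 : 0 < c by rewrite (lt_le_trans _ c_ge)// divr_gt0.
by rewrite inver gt_eqF// -EFinM lee_fin ler_pdivrMr// mulrC -ler_pdivrMr.
Qed.

End PiDual.

Theorem corollary3p35 (R : realType) (E : normedModType R[i]) (n : nat)
    (n_gt0 : (0 < n)%N) :
  [/\ phi_max E n =
        ereal_sup [set (\sum_(j < n) rnorm (lambda j))%:E
                  | lambda in [set lambda : 'I_n -> topdual E |
                                (mu1 lambda <= 1)%E]],
      ereal_sup [set (\sum_(j < n) rnorm (lambda j))%:E
                | lambda in [set lambda : 'I_n -> topdual E |
                              (mu1 lambda <= 1)%E]] =
        ereal_sup [set (\sum_(j < n) rnorm (lambda j))%:E
                  | lambda in [set lambda : 'I_n -> topdual E |
                      forall zeta, torus R n zeta ->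
                        rnorm (\sum_(j < n) zeta j *: lambda j) <= 1]],
      phi_max E n = pi1 (topdual E) n &
      (n%:R%:E / cconst (topdual E) n <= pi1 (topdual E) n)%E].
Proof.
have phiE := phi_max_summingE E n_gt0.
(* [pi1 (topdual E) n] unfolds to the supremum in [phiE]; the two suprema over families of
   functionals have the same index set. *)
split=> //; last exact: pi1_ge_cconst.
congr (ereal_sup (_ @` _)); apply/seteqP.
by split=> l /= /mu1_le1_torusE.
Qed.
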